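(* Given an irreducible Markov chain with finite state space $\Omega$ and stationary distribution $\pi$, let $A,C\subseteq\Omega$. Then $$\pi(A)\le\frac{d^+(A,C)}{d^+(A,C)+d^-(C,A)}.$$
   Context: The chain $X=(X_t)_{t\ge 0}$ is in discrete time; the hitting time of $A\subseteq\Omega$ is $\tau_A=\min\{t: X_t\in A\}$, and $\mathbb{E}_x$ denotes expectation for the chain started at $X_0=x$. For two sets $A,B\subseteq\Omega$, $$d^+(A,B)=\max_{x\in A}\mathbb{E}_x[\tau_B],\qquad d^-(A,B)=\min_{x\in A}\mathbb{E}_x[\tau_B].$$ *)

(* Defs.v *)
From HB Require Import structures.
From mathcomp Require Import all_boot all_order all_algebra.
From mathcomp Require Import all_classical all_reals all_analysis.

Set Implicit Arguments.
Unset Strict Implicit.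
Unset Printing Implicit Defensive.

Import Order.TTheory GRing.Theory Num.Theory.
Local Open Scope ring_scope.

Section TransitionMatrix.
Context {R : realType} {Omega : finType}.
Implicit Types (P : Omega -> Omega -> R) (pi : Omega -> R).

Definition stochastic P :=
  (forall x y, 0 <= P x y) /\ (forall x, \sum_y P x y = 1).

Fixpoint transition_pow P (n : nat) (x y : Omega) : R :=
  if n is m.+1 then \sum_z P x z * transition_pow P m z y else (x == y)%:R.

Definition irreducible P :=
  forall x y, exists n, 0 < transition_pow P n x y.

Definition stationary_distribution P pi :=
  [/\ forall x, 0 <= pi x,
      \sum_x pi x = 1 &
      forall y, \sum_x pi x * P x y = pi y].

End TransitionMatrix.

Section MarkovChain.
Context {R : realType} {Omega : finType} {d : measure_display}.
Context {T : measurableType d}.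
Implicit Types (P : Omega -> Omega -> R) (X : nat -> T -> Omega).
Implicit Types (A B : {set Omega}).

Definition trajectory X (n : nat) (s : nat -> Omega) : set T :=
  [set w | forall i, (i <= n)%N -> X i w = s i]%classic.

(* The Markov property is written in product form; dividing by the
   probability of the past trajectory, when it is nonzero, gives
   Pr(X_{n+1} = s_{n+1} | X_0 = s_0, ..., X_n = s_n) = P(s_n, s_{n+1}). *)
Definition markov_chain P (Pr : probability T R) X (x : Omega) :=
  [/\ forall t y, measurable (X t @^-1` [set y])%classic,
      Pr (X 0%N @^-1` [set x])%classic = 1%E &
      forall n s, (Pr (trajectory X n.+1 s) =
                   Pr (trajectory X n s) * (P (s n) (s n.+1))%:E)%E].

(* The value is +oo when A is never reached. *)
Definition hitting_time X A (w : T) : \bar R :=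
  ereal_inf [set (t%:R)%:E | t in [set t : nat | X t w \in A]]%classic.

Definition expected_hitting_time (Pr : probability T R) X A : \bar R :=
  (\int[Pr]_w hitting_time X A w)%E.

(* Pr x is the law of the chain started at x.  The neutral elements -oo and
   +oo make these the true maximum and minimum as soon as A is nonempty. *)
Definition dplus (Pr : Omega -> probability T R) X A B : \bar R :=
  \big[maxe/-oo%E]_(x in A) expected_hitting_time (Pr x) X B.

Definition dminus (Pr : Omega -> probability T R) X A B : \bar R :=
  \big[mine/+oo%E]_(x in A) expected_hitting_time (Pr x) X B.

End MarkovChain.

(* Main.v *)
Require Import Defs.
From mathcomp Require Import all_boot all_order all_algebra.
From mathcomp Require Import all_classical all_reals all_analysis.
From mathcomp Require Import measurable_realfun ring lra.

Set Implicit Arguments.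
Unset Strict Implicit.
Unset Printing Implicit Defensive.

Import Order.TTheory GRing.Theory Num.Theory.
Import numFieldNormedType.Exports.
Local Open Scope ring_scope.

(** Run the stationary chain and call it red while its last visit to the union
of A and C was in A, blue while it was in C.  A red period starts in A and ends
when C is hit, so it lasts at most D = d+(A,C) on average; a blue period starts
in C and ends when A is hit, so it lasts at least m = d-(C,A) on average.  The
periods alternate, hence the red fraction of time is at most D / (D + m), and
every visit to A is red.

The proof carries this out with the red part mu of the stationary distribution
instead of a long run of the chain.  The measure mu equals pi on A, vanishes on
C and is balanced elsewhere ([last_visit_measure]); put nu = pi - mu.  By
stationarity, mu has its sources on A, where the inflow is nu P, and its sinks
on C, where the outflow is mu P; for nu the roles are exchanged, and both
flows have the same total r, the rate of color changes.  Testing the balance of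
mu against the mean hitting time h of C, which satisfies h = 1 + P h off C,
gives mu(1) <= r D ([mass_eq_flux]); likewise nu(1) >= r m.  Since nu(1) =
1 - mu(1) and pi(A) <= mu(1), eliminating r gives pi(A) (D + m) <= D
([stationary_mass_bound]).  When A and C meet, m = 0 and the claim is
pi(A) <= 1.

It remains to identify the expected hitting times with finite solutions of
h = 1 + P h.  The probability of avoiding C up to time n, computed from the
Markov property ([trajectory_avoids]), obeys a first-step recursion, and the
expectation is the sum of these probabilities over n.  Irreducibility makes
them contract uniformly after some fixed number of steps, so that the sum is
finite ([series_survival_bounded]) and the recursion passes to the limit
([mean_hitting_time_first_step]). *)

(** * Survival probabilities and mean hitting times of a kernel *)

Section Survival.
Context {R : realType} {Omega : finType}.
Variables (P : Omega -> Omega -> R) (C : {set Omega}).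

(** The probability that the chain started at x is outside C at all times
    0, ..., n, written as a first-step recursion on the kernel. *)
Fixpoint survival (n : nat) (x : Omega) : R :=
  if x \in C then 0
  else if n is m.+1 then \sum_y P x y * survival m y else 1.

(** E(tau) is the sum over n of Pr(tau > n). *)
Definition mean_hitting_time (x : Omega) : R := limn (series (survival ^~ x)).

Lemma survival_in n x : x \in C -> survival n x = 0.
Proof. by case: n => [|n] /= ->. Qed.

Lemma survivalS n x :
  x \notin C -> survival n.+1 x = \sum_y P x y * survival n y.
Proof. by move=> /= /negPf ->. Qed.

Hypothesis stoP : stochastic P.

Lemma survival_ge0 n x : 0 <= survival n x.
Proof.
case: stoP => P0 _; elim: n x => [|n IH] x /=; case: ifP => // _.
by apply: sumr_ge0 => y _; rewrite mulr_ge0.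
Qed.

Lemma survival_le1 n x : survival n x <= 1.
Proof.
case: stoP => P0 P1; elim: n x => [|n IH] x /=; case: ifP => // _.
by rewrite -(P1 x); apply: ler_sum => y _; rewrite ler_piMr.
Qed.

Lemma survival_nonincreasing m n x :
  (m <= n)%N -> survival n x <= survival m x.
Proof.
case: stoP => P0 P1.
have step k y : survival k.+1 y <= survival k y.
  elim: k y => [|k IH] y; case yC: (y \in C); try by rewrite !survival_in.
    by rewrite [leRHS]/= yC survival_le1.
  rewrite !survivalS ?yC //.
  by apply: ler_sum => z _; rewrite ler_wpM2l.
move=> /subnK <-; elim: (n - m)%N => // k IH.
exact: le_trans (step _ _) IH.
Qed.

(** The paths that avoid C up to time n and those that sit at c in C at time n
    are disjoint; this turns irreducibility into a bound on survival. *)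
Lemma survival_transition n x c :
  c \in C -> survival n x + transition_pow P n x c <= 1.
Proof.
case: stoP => P0 P1 cC; elim: n x => [|n IH] x.
  rewrite /=; case: eqVneq => [->|_]; first by rewrite cC add0r.
  by rewrite addr0; case: ifP.
have le1 : \sum_y P x y * survival n y + transition_pow P n.+1 x c <= 1.
  rewrite /= -big_split -(P1 x); apply: ler_sum => y _ /=.
  by rewrite -mulrDr ler_piMr.
apply: le_trans le1; rewrite lerD2r [leLHS]/=; case: ifP => // _.
by apply: sumr_ge0 => y _; rewrite mulr_ge0 ?survival_ge0.
Qed.

(** Surviving n + k steps means surviving n steps and then k more, whatever
    the state reached in between. *)
Lemma survival_contract k theta :
  (forall x, survival k x <= theta) ->
  forall n x, survival (n + k) x <= theta * survival n x.
Proof.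
case: stoP => P0 P1 Hk; elim=> [|n IH] x.
  case xC : (x \in C); first by rewrite !survival_in ?mulr0.
  by rewrite /= xC mulr1.
rewrite addSn; case xC : (x \in C); first by rewrite !survival_in ?mulr0.
rewrite !survivalS ?xC // mulr_sumr; apply: ler_sum => y _.
by rewrite mulrCA ler_wpM2l.
Qed.

Hypotheses (irrP : irreducible P) (C0 : C != finset.set0).

(** By irreducibility C is reached from every state with positive
    probability; the largest of the finitely many numbers of steps works for
    all of them, because survival does not increase with time. *)
Lemma survival_lt1 : exists k, forall x, survival k x < 1.
Proof.
have [c cC] := set0Pn _ C0.
pose k x := xchoose (irrP x c).
exists (\max_x k x)%N => x.
apply: le_lt_trans (survival_nonincreasing _ (leq_bigmax x)) _.
have := xchooseP (irrP x c); rewrite -/(k x) => kpos.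
by have := survival_transition (k x) x cC; lra.
Qed.

(** If survival over k steps is at most theta < 1 everywhere, the tails decay
    geometrically, and k / (1 - theta) bounds every partial sum. *)
Lemma series_survival_bounded :
  exists M, forall n x, series (survival ^~ x) n <= M.
Proof.
have [k klt1] := survival_lt1.
have [c cC] := set0Pn _ C0.
pose theta := survival k [arg max_(x > c) survival k x]%O.
have kle x : survival k x <= theta.
  by rewrite /theta; case: arg_maxP => // y _ /(_ x isT).
have theta1 : theta < 1 by exact: klt1.
have theta0 : 0 <= theta by exact: survival_ge0.
exists (k%:R / (1 - theta)) => n x; rewrite /series /=.
rewrite ler_pdivlMr ?subr_gt0 // mulrBr mulr1 lerBlDr.
(* Among the first n + k terms, k are at most 1 each and the remaining n are
   at most theta times the first n terms. *)
apply: (@le_trans _ _ (\sum_(0 <= i < n + k) survival i x)).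
  rewrite [leRHS](big_cat_nat (n := n)) ?leq_addr //= lerDl.
  by apply: sumr_ge0 => i _; exact: survival_ge0.
rewrite (big_cat_nat (n := k)) ?leq_addl //=; apply: lerD.
  rewrite -[leRHS](_ : \sum_(0 <= i < k) 1 = _); last first.
    by rewrite sumr_const_nat subn0.
  by apply: ler_sum => i _; exact: survival_le1.
rewrite -{1}[k]add0n big_addn addnK mulrC mulr_sumr.
by apply: ler_sum => i _; exact: survival_contract.
Qed.

Lemma mean_hitting_time_cvg x :
  (series (survival ^~ x) n @[n --> \oo] --> mean_hitting_time x)%classic.
Proof.
have [M HM] := series_survival_bounded.
apply: nondecreasing_is_cvgn.
  by apply: nondecreasing_series => n _ _; exact: survival_ge0.
by exists M => _ [n _ <-]; exact: HM.
Qed.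

Lemma mean_hitting_time_ge0 x : 0 <= mean_hitting_time x.
Proof.
apply: limr_ge; first by apply: cvgP; exact: mean_hitting_time_cvg.
by apply: nearW => n; apply: sumr_ge0 => i _; exact: survival_ge0.
Qed.

Lemma mean_hitting_time_in x : x \in C -> mean_hitting_time x = 0.
Proof.
move=> xC; apply: cvg_lim => //.
rewrite (_ : series _ = fun=> 0); first exact: cvg_cst.
by apply/funext => n; apply: big1 => i _; exact: survival_in.
Qed.

Lemma mean_hitting_time_first_step x : x \notin C ->
  mean_hitting_time x = 1 + \sum_y P x y * mean_hitting_time y.
Proof.
move=> xC.
apply: cvg_lim => //; rewrite -cvg_shiftS.
rewrite (_ : (fun n => _) =
             fun n => 1 + \sum_y P x y * series (survival ^~ y) n); last first.
  apply/funext => n; rewrite /series /= big_nat_recl //= (negPf xC).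
  congr (_ + _); under [RHS]eq_bigr do rewrite mulr_sumr.
  by rewrite exchange_big.
apply: cvgD; first exact: cvg_cst.
apply: cvg_big; first exact: add_continuous.
by move=> y _; apply: cvgMr; exact: mean_hitting_time_cvg.
Qed.
End Survival.

(** * The law of the hitting time *)

Section HittingTimeLaw.
Context {R : realType} {Omega : finType} {d : measure_display}.
Context {T : measurableType d}.
Variables (X : nat -> T -> Omega) (C : {set Omega}).

Definition avoids (n k : nat) : set T :=
  [set w | forall i, (n <= i <= n + k)%N -> X i w \notin C]%classic.

Lemma measure_fiber_sum (mu : {measure set T -> \bar R}) (Y : T -> Omega)
    (E : set T) :
  (forall y, measurable (Y @^-1` [set y])%classic) -> measurable E ->
  mu E = (\sum_y mu (E `&` Y @^-1` [set y])%classic)%E.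
Proof.
move=> mY mE.
rewrite {1}(_ : E = \bigcup_(y in [set: Omega]) (E `&` Y @^-1` [set y]))%classic;
  last first.
  by apply/seteqP; split=> [w Ew|w [y _ []]//]; exists (Y w).
have finO : finite_set [set: Omega]%classic by exact: finite_finset.
rewrite measure_fin_bigcup //; last 2 first.
- by move=> y z _ _ [w [[_ <-] [_ <-]]].
- by move=> y _; exact: measurableI.
rewrite fsbig_finite //=; apply: perm_big; apply: uniq_perm.
- exact: finmap.fset_uniq.
- exact: index_enum_uniq.
- by move=> y; rewrite mem_index_enum in_fset_set // in_setT.
Qed.

Hypothesis mX : forall t y, measurable (X t @^-1` [set y])%classic.

Lemma measurable_state_in t (B : {pred Omega}) :
  measurable [set w | X t w \in B]%classic.
Proof.
have -> : [set w | X t w \in B]%classic =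
          (\bigcup_(y in [set` B]) (X t @^-1` [set y]))%classic.
  apply/seteqP; split=> [w /= XB|w [y /= yB /= Xy]]; last by rewrite Xy.
  by exists (X t w).
by apply: fin_bigcup_measurable => [|y _]; [exact: finite_finset|exact: mX].
Qed.

Lemma measurable_trajectory n s : measurable (trajectory X n s).
Proof.
have -> : trajectory X n s =
    (\bigcap_(i in [set i | (i <= n)%N]) (X i @^-1` [set s i]))%classic by [].
by apply: bigcap_measurableType => i _; exact: mX.
Qed.

Lemma measurable_avoids n k : measurable (avoids n k).
Proof.
have -> : avoids n k = (\bigcap_(i in [set i | (n <= i <= n + k)%N])
               [set w | X i w \in [predC C]])%classic by [].
by apply: bigcap_measurableType => i _; exact: measurable_state_in.
Qed.

(** The hitting time is the number of times n with tau > n; when C is never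
    hit both sides are +oo. *)
Lemma hitting_time_series (w : T) :
  (hitting_time X C w = \sum_(n <oo) (\1_(avoids 0 n) w)%:E :> \bar R)%E.
Proof.
have ind1 n : avoids 0 n w -> (\1_(avoids 0 n) w)%:E = 1%E :> \bar R.
  by move=> avw; rewrite indicE mem_set.
have ind0 n : ~ avoids 0 n w -> (\1_(avoids 0 n) w)%:E = 0%E :> \bar R.
  by move=> avw; rewrite indicE memNset.
have ge0 n : (0 <= (\1_(avoids 0 n) w)%:E :> \bar R)%E by rewrite lee_fin.
have sum1 t : (forall i, (i < t)%N -> X i w \notin C) ->
    (\sum_(0 <= n < t) (\1_(avoids 0 n) w)%:E = t%:R%:E :> \bar R)%E.
  move=> lt_t; rewrite sumEFin -[t in RHS]subn0 -sumr_const_nat.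
  congr EFin; apply: eq_big_nat => n /andP[_ nt]; rewrite indicE mem_set //.
  by move=> i /andP[_ ile]; apply: lt_t; exact: leq_ltn_trans ile nt.
have [[t0 Xt0]|nohit] := pselect (exists t, X t w \in C); last first.
  rewrite /hitting_time (_ : [set _ | t in _]%classic = set0)%classic.
    rewrite ereal_inf0; apply/esym/eqyP => M M0.
    apply: le_trans (nneseries_lim_ge (Num.truncn M).+1 _) => //.
    rewrite sum1 ?lee_fin ?ltW ?truncnS_gt // => i _.
    by apply/negP => XiC; apply: nohit; exists i.
  by apply/seteqP; split=> // _ [t /= XtC _]; apply: nohit; exists t.
case: (find_ex_minn (ex_intro (fun t => X t w \in C) t0 Xt0)) => t XtC tmin.
transitivity (t%:R%:E : \bar R).
  apply/eqP; rewrite eq_le; apply/andP; split.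
    by apply: ereal_inf_lbound; exists t.
  apply: le_ereal_inf_tmp => _ [u /= XuC <-].
  by rewrite lee_fin ler_nat tmin.
rewrite (nneseries_split 0 t) // add0n sum1 => [|i it].
  rewrite eseries0 ?adde0 // => n tn _; apply: ind0 => /(_ t).
  by rewrite /= add0n tn XtC => /(_ isT).
by apply: contraL it => /tmin; rewrite -leqNgt.
Qed.

Lemma expected_hitting_time_series (mu : probability T R) :
  (expected_hitting_time mu X C = \sum_(n <oo) mu (avoids 0 n))%E.
Proof.
rewrite /expected_hitting_time.
under eq_integral do rewrite hitting_time_series.
rewrite integral_nneseries //.
  apply: eq_eseriesr => n _.
  by rewrite integral_indic ?setIT //; exact: measurable_avoids.
move=> n; apply/measurable_EFinP; apply: measurable_indic.
exact: measurable_avoids.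
Qed.

End HittingTimeLaw.

Section MarkovHitting.
Context {R : realType} {Omega : finType} {d : measure_display}.
Context {T : measurableType d}.
Variables (P : Omega -> Omega -> R) (X : nat -> T -> Omega) (C : {set Omega}).
Variables (Pr : probability T R) (x : Omega).
Hypotheses (stoP : stochastic P) (mcX : markov_chain P Pr X x).

(** The probabilities of trajectories are given by extending them at the end,
    whereas survival recurses on the first step.  The two meet by splitting
    along the state y at time n + 1: each piece is a longer trajectory followed
    by a shorter avoidance, to which the induction on k applies. *)
Lemma trajectory_avoids n k s :
  (Pr (trajectory X n s `&` avoids X C n k)%classic =
   Pr (trajectory X n s) * (survival P C k (s n))%:E)%E.
Proof.
case: mcX => mX _ markov.
have in_C m l t : t m \in C ->
    (trajectory X m t `&` avoids X C m l = set0)%classic.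
  move=> tC; apply/seteqP; split=> // w [/(_ m (leqnn m)) Xt /(_ m)].
  by rewrite Xt tC leqnn leq_addr => /(_ isT).
elim: k n s => [|k IH] n s.
all: have [sC|sC] := boolP (s n \in C);
  first by rewrite in_C // survival_in // mule0 measure0.
  rewrite /= (negPf sC) mule1; congr (Pr _); apply/seteqP.
  split=> [w []//|w tw]; split=> // i; rewrite addn0 -eqn_leq => /eqP <-.
  by rewrite tw.
rewrite (measure_fiber_sum Pr (mX n.+1)); last first.
  by apply: measurableI; [exact: measurable_trajectory|exact: measurable_avoids].
rewrite survivalS // -sumEFin ge0_sume_distrr; last first.
  by move=> y _; rewrite lee_fin mulr_ge0 ?survival_ge0 //; case: stoP.
apply: eq_bigr => y _.
(* The trajectory s redirected to y at time n + 1. *)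
pose s' i := if i == n.+1 then y else s i.
have s's i : (i <= n)%N -> s' i = s i.
  by move=> lein; rewrite /s' ltn_eqF.
have trs' : trajectory X n s' = trajectory X n s.
  by apply/seteqP; split=> w tw i lein; have := tw i lein; rewrite s's.
have s'y : s' n.+1 = y by rewrite /s' eqxx.
have := IH n.+1 s'; rewrite markov trs' s's // s'y -muleA -EFinM => <-.
congr (Pr _); apply/seteqP; split=> w.
  move=> [[tw aw] /= Xy]; split=> i.
    rewrite leq_eqVlt => /orP[/eqP ->|]; first by rewrite s'y.
    by rewrite ltnS => lein; rewrite s's // tw.
  by move=> /andP[ni ik]; apply: aw; rewrite (ltnW ni) -addSnnS.
move=> [tw aw]; split; last by rewrite /= tw.
split=> [i lein|i]; first by rewrite tw ?leqW // s's.
rewrite leq_eqVlt => /andP[/orP[/eqP <- _|ni ik]].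
  by rewrite tw ?leqW // s's.
by apply: aw; rewrite ni addSnnS.
Qed.

(** The law Pr charges only paths started at x, so that the trajectory of
    length 0 at x can be added to the event. *)
Lemma avoids_survival n : Pr (avoids X C 0 n) = (survival P C n x)%:E.
Proof.
case: mcX => mX X0 _.
have trx : trajectory X 0 (fun=> x) = (X 0%N @^-1` [set x])%classic.
  apply/seteqP; split=> [w /(_ 0 isT)//|w /= Xw i].
  by rewrite leqn0 => /eqP ->.
have -> : (Pr (avoids X C 0 n) = Pr (avoids X C 0 n `\` X 0%N @^-1` [set x])
    + Pr (avoids X C 0 n `&` X 0%N @^-1` [set x]))%classic%E.
  by apply: measureDI; [exact: measurable_avoids|exact: mX].
have -> : Pr (avoids X C 0 n `\` X 0%N @^-1` [set x])%classic = 0%E.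
  apply/eqP; rewrite eq_le measure_ge0 andbT.
  have <- : (Pr (~` (X 0%N @^-1` [set x])) = 0)%classic%E.
    by rewrite probability_setC // X0 subee.
  rewrite setDE; apply: measureIr; first exact: measurable_avoids.
  exact: measurableC.
by rewrite add0e setIC -trx trajectory_avoids trx X0 mul1e.
Qed.

Hypotheses (irrP : irreducible P) (C0 : C != finset.set0).

Lemma expected_hitting_timeE :
  expected_hitting_time Pr X C = (mean_hitting_time P C x)%:E.
Proof.
have mX : forall t y, measurable (X t @^-1` [set y])%classic by case: mcX.
rewrite expected_hitting_time_series // /mean_hitting_time -EFin_lim; last first.
  by apply: cvgP; exact: mean_hitting_time_cvg.
apply: congr_lim; apply/funext => n /=; rewrite /series /= -sumEFin.
by apply: eq_bigr => i _; exact: avoids_survival.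
Qed.
End MarkovHitting.

(** * Stationary mass carried by the last visit *)

Section LastVisit.
Context {R : realType} {Omega : finType}.
Variables (P : Omega -> Omega -> R) (pi : Omega -> R) (A C : {set Omega}).

(** The part of pi y carried by stationary paths now at y whose last visit to
    A :|: C was in A and happened at most n steps ago. *)
Fixpoint last_visit_approx (n : nat) (y : Omega) : R :=
  if y \in A then pi y
  else if y \in C then 0
  else if n is m.+1 then \sum_x last_visit_approx m x * P x y else 0.

Hypotheses (stoP : stochastic P) (pi_stat : stationary_distribution P pi).

Lemma last_visit_approx_bounds n y : 0 <= last_visit_approx n y <= pi y.
Proof.
case: stoP pi_stat => P0 P1 [pi0 _ piP].
elim: n y => [|n IH] y /=.
  by case: ifP => _; [|case: ifP => _]; rewrite ?lexx pi0.
case: ifP => _; [|case: ifP => _]; rewrite ?lexx ?pi0 //.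
apply/andP; split.
  by apply: sumr_ge0 => x _; rewrite mulr_ge0 //; case/andP: (IH x).
rewrite -[leRHS]piP; apply: ler_sum => x _; rewrite ler_wpM2r //.
by case/andP: (IH x).
Qed.

Lemma last_visit_approx_nondecreasing y :
  {homo last_visit_approx ^~ y : m n / (m <= n)%N >-> m <= n}.
Proof.
case: stoP => P0 P1; apply/nondecreasing_seqP => n.
elim: n y => [|n IH] y; case yA: (y \in A); try by rewrite /= yA.
all: case yC: (y \in C); try by rewrite /= yA yC.
  by rewrite [leLHS]/= yA yC; case/andP: (last_visit_approx_bounds 1 y).
rewrite [leLHS]/= [leRHS]/= yA yC.
by apply: ler_sum => x _; rewrite ler_wpM2r.
Qed.

(** The stationary probability of being at x with the last visit to A :|: C
    in A has these properties.  It is the limit of [last_visit_approx], which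
    stays below pi because pi is stationary; balance off A :|: C is the limit
    of the recursion. *)
Lemma last_visit_measure : [disjoint A & C] ->
  exists mu : Omega -> R,
  [/\ forall x, 0 <= mu x <= pi x,
      {in A, mu =1 pi},
      {in C, forall x, mu x = 0} &
      forall y, y \notin A -> y \notin C -> \sum_x mu x * P x y = mu y].
Proof.
move=> AC.
pose mu x := limn (last_visit_approx ^~ x).
have mu_cvg x : (last_visit_approx n x @[n --> \oo] --> mu x)%classic.
  apply: nondecreasing_is_cvgn; first exact: last_visit_approx_nondecreasing.
  by exists (pi x) => _ [n _ <-]; case/andP: (last_visit_approx_bounds n x).
have mu_cst x r : (forall n, last_visit_approx n x = r) -> mu x = r.
  by move=> /funext mur; apply: cvg_lim => //; rewrite mur; exact: cvg_cst.
exists mu; split=> [x|x xA|x xC|y yA yC].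
- have cvx : cvgn (last_visit_approx ^~ x) by apply: cvgP; exact: mu_cvg.
  rewrite limr_ge ?limr_le //; apply: nearW => n;
    by case/andP: (last_visit_approx_bounds n x).
- by apply: mu_cst => -[|n] /=; rewrite xA.
- by apply: mu_cst => -[|n] /=; rewrite xC (disjointFl AC xC).
- apply/esym; rewrite -[LHS]/(limn (last_visit_approx ^~ y)).
  apply: cvg_lim => //; rewrite -cvg_shiftS /= (negPf yA) (negPf yC).
  apply: cvg_big; first exact: add_continuous.
  by move=> x _; apply: cvgMl; exact: mu_cvg.
Qed.

End LastVisit.

Section Potential.
Context {R : realType} {Omega : finType}.
Variables (P : Omega -> Omega -> R).

(** Moving P from nu to h turns the defect of balance of nu into h - P h, which
    is 1 off B.  When nu is fed outside B and absorbed in B, this says that its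
    mass is the inflow times the mean time h until absorption. *)
Lemma mass_eq_flux (nu h : Omega -> R) (B : {set Omega}) :
  {in B, forall x, nu x = 0} ->
  (forall x, x \notin B -> h x = 1 + \sum_y P x y * h y) ->
  \sum_x nu x = \sum_y (nu y - \sum_x nu x * P x y) * h y.
Proof.
move=> nuB hE.
have -> : \sum_y (nu y - \sum_x nu x * P x y) * h y =
          \sum_x nu x * (h x - \sum_y P x y * h y).
  under eq_bigr do rewrite mulrBl mulr_suml.
  under [RHS]eq_bigr do rewrite mulrBr mulr_sumr.
  rewrite !sumrB exchange_big; congr (_ - _).
  by apply: eq_bigr => x _; apply: eq_bigr => y _; rewrite mulrA.
apply: eq_bigr => x _; have [/nuB ->|/hE {1}->] := boolP (x \in B).
  by rewrite mul0r.
by rewrite addrK mulr1.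
Qed.

(** The comparison of red and blue periods: the rate r of passages into A
    equals that into C, the mass of mu is at most r D and that of pi - mu at
    least r m. *)
Lemma stationary_mass_bound (pi hA hC : Omega -> R) (A C : {set Omega})
    (D m : R) :
  stochastic P -> stationary_distribution P pi -> [disjoint A & C] ->
  {in A, forall x, hA x = 0} ->
  (forall x, x \notin A -> hA x = 1 + \sum_y P x y * hA y) ->
  {in C, forall x, hC x = 0} ->
  (forall x, x \notin C -> hC x = 1 + \sum_y P x y * hC y) ->
  {in A, forall x, hC x <= D} ->
  {in C, forall x, m <= hA x} ->
  0 <= D -> 0 <= m ->
  (\sum_(x in A) pi x) * (D + m) <= D.
Proof.
move=> stoP pi_stat AC hA0 hAE hC0 hCE hCD mhA D0 m0.
have [mu [mu_bounds muA muC mu_bal]] := last_visit_measure stoP pi_stat AC.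
case: (stoP) (pi_stat) => P0 P1 [pi0 pi1 piP].
have mu0 x : 0 <= mu x by case/andP: (mu_bounds x).
have mupi x : mu x <= pi x by case/andP: (mu_bounds x).
pose nu x := pi x - mu x.
have nu0 x : 0 <= nu x by rewrite subr_ge0.
pose inflowA y := \sum_x nu x * P x y.
pose inflowC y := \sum_x mu x * P x y.
have flow y : inflowA y + inflowC y = pi y.
  by rewrite -piP -big_split; apply: eq_bigr => x _ /=; rewrite /nu; ring.
have AnC y : y \in A -> y \notin C by move=> yA; rewrite (disjointFr AC yA).
(* The defect of balance of mu is a source on A and a sink on C. *)
have divmu y : mu y - inflowC y =
    (if y \in A then inflowA y else 0) - (if y \in C then inflowC y else 0).
  have [yA|yA] := boolP (y \in A).
    by rewrite (negPf (AnC y yA)) muA // -flow; ring.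
  have [yC|yC] := boolP (y \in C); first by rewrite muC.
  by rewrite /inflowC mu_bal // !subrr.
pose r := \sum_(y in A) inflowA y.
have rC : \sum_(y in C) inflowC y = r.
  have : \sum_y (mu y - inflowC y) = 0.
    rewrite sumrB exchange_big /=; apply/eqP; rewrite subr_eq0; apply/eqP.
    by apply: eq_bigr => x _; rewrite -mulr_sumr P1 mulr1.
  under eq_bigr do rewrite divmu; rewrite sumrB -!big_mkcond -/r /=.
  by move/subr0_eq.
have mu_mass : \sum_x mu x <= r * D.
  rewrite (mass_eq_flux muC hCE) mulr_suml [leRHS]big_mkcond.
  apply: ler_sum => y _; rewrite -/(inflowC y) divmu.
  have [yA|yA] := boolP (y \in A).
    rewrite (negPf (AnC y yA)) subr0 ler_wpM2l ?hCD //.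
    by apply: sumr_ge0 => x _; rewrite mulr_ge0.
  have [yC|yC] := boolP (y \in C); first by rewrite hC0 // mulr0.
  by rewrite subrr mul0r.
have nuA : {in A, forall x, nu x = 0} by move=> x xA; rewrite /nu muA ?subrr.
have nu_mass : r * m <= \sum_x nu x.
  rewrite (mass_eq_flux nuA hAE) -rC mulr_suml [leLHS]big_mkcond.
  apply: ler_sum => y _.
  have -> : nu y - \sum_x nu x * P x y = - (mu y - inflowC y).
    by rewrite -/(inflowA y) /nu -flow; ring.
  rewrite divmu; have [yC|yC] := boolP (y \in C).
    have yA : y \notin A by apply: contraL yC; exact: AnC.
    rewrite (negPf yA) sub0r opprK ler_wpM2l ?mhA //.
    by apply: sumr_ge0 => x _; rewrite mulr_ge0.
  rewrite subr0; have [yA|yA] := boolP (y \in A); first by rewrite hA0 // mulr0.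
  by rewrite oppr0 mul0r.
have nu1 : \sum_x nu x = 1 - \sum_x mu x by rewrite sumrB pi1.
have piA : \sum_(x in A) pi x <= \sum_x mu x.
  rewrite big_mkcond; apply: ler_sum => x _.
  by case: ifP => [xA|_] //; rewrite muA.
apply: (@le_trans _ _ ((\sum_x mu x) * (D + m))).
  by rewrite ler_wpM2r // addr_ge0.
(* Eliminating r: mu(1) m <= r D m <= D (1 - mu(1)). *)
have := ler_wpM2r m0 mu_mass; have := ler_wpM2l D0 nu_mass; rewrite nu1.
nra.
Qed.

End Potential.

(** * The bound on the stationary measure *)

Section Extrema.
Context {R : realType} {Omega : finType}.
Variables (f : Omega -> \bar R) (h : Omega -> R) (A : {set Omega}).
Hypotheses (fh : forall x, f x = (h x)%:E) (A0 : A != finset.set0).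

Lemma bigmaxe_attained : exists2 a, a \in A &
  \big[maxe/-oo%E]_(x in A) f x = (h a)%:E /\ {in A, forall x, h x <= h a}.
Proof.
have [a0 a0A] := set0Pn _ A0.
case: (@arg_maxP _ _ _ a0 (mem A) h a0A) => a aA amax.
exists a => //; split=> //; apply/le_anti/andP; split.
  by apply: bigmax_le => [|x xA]; rewrite ?leNye // fh lee_fin; exact: amax.
by rewrite -fh; exact: le_bigmax_cond.
Qed.

Lemma bigmine_attained : exists2 a, a \in A &
  \big[mine/+oo%E]_(x in A) f x = (h a)%:E /\ {in A, forall x, h a <= h x}.
Proof.
have [a0 a0A] := set0Pn _ A0.
case: (@arg_minP _ _ _ a0 (mem A) h a0A) => a aA amin.
exists a => //; split=> //; apply/le_anti/andP; split.
  by rewrite -fh; exact: bigmin_le_cond.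
by apply: le_bigmin => [|x xA]; rewrite ?leey // fh lee_fin; exact: amin.
Qed.

End Extrema.

Theorem proposition1p4 (R : realType) (Omega : finType)
  (P : Omega -> Omega -> R) (pi : Omega -> R)
  (d : measure_display) (T : measurableType d)
  (X : nat -> T -> Omega) (Pr : Omega -> probability T R)
  (A C : {set Omega}) :
  stochastic P ->
  irreducible P ->
  stationary_distribution P pi ->
  (forall x, markov_chain P (Pr x) X x) ->
  A != finset.set0 ->
  C != finset.set0 ->
  (dplus Pr X A C + dminus Pr X C A != 0)%E ->
  ((\sum_(x in A) pi x)%:E <=
     dplus Pr X A C / (dplus Pr X A C + dminus Pr X C A))%E.
Proof.
move=> stoP irrP pi_stat mcX A0 C0.
pose hA := mean_hitting_time P A; pose hC := mean_hitting_time P C.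
have EA x : expected_hitting_time (Pr x) X A = (hA x)%:E.
  exact: expected_hitting_timeE.
have EC x : expected_hitting_time (Pr x) X C = (hC x)%:E.
  exact: expected_hitting_timeE.
have [a aA [Da hCa]] := bigmaxe_attained EC A0.
have [c cC [mc hAc]] := bigmine_attained EA C0.
rewrite /dplus /dminus Da mc -EFinD eqe => Dm0.
have D0 : 0 <= hC a by exact: mean_hitting_time_ge0.
have m0 : 0 <= hA c by exact: mean_hitting_time_ge0.
have Dm : 0 < hC a + hA c by rewrite lt_def Dm0 addr_ge0.
rewrite inver (negPf Dm0) -EFinM lee_fin ler_pdivlMr //.
have [AC|] := boolP [disjoint A & C].
  apply: (stationary_mass_bound stoP pi_stat AC) hCa hAc D0 m0.
  - by move=> x; exact: mean_hitting_time_in.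
  - by move=> x; exact: mean_hitting_time_first_step.
  - by move=> x; exact: mean_hitting_time_in.
  - by move=> x; exact: mean_hitting_time_first_step.
(* A common state makes the minimum over C vanish, and the bound reads
   pi(A) <= 1. *)
move=> /pred0Pn[z /andP[/= zA zC]].
have -> : hA c = 0.
  by apply/eqP; rewrite eq_le m0 -(mean_hitting_time_in P zA) hAc.
case: pi_stat => pi0 pi1 _; rewrite addr0 ler_piMl // -pi1.
by rewrite [leRHS](bigID (mem A)) lerDl sumr_ge0.
Qed.
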